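(* Suppose the following hold, with constants $c_0,\gamma,\alpha,k_0,k_1,k_2,\lambda>0$ and $s>1$ independent of $\ell$. (i) The cost $c_\ell$ of evaluating the (unnormalized) density $\pi^{(\ell)}$ satisfies $c_\ell\le c_0 s^{\gamma\ell}$ for all $\ell\in\mathbb{N}$. (ii) $\mathrm{KL}(\mu_0\,\|\,\pi^{(\ell)})\le k_0$ and $\mathrm{KL}(\pi^{(\ell)}\,\|\,\pi)\le k_1 s^{-\alpha\ell}$ for all $\ell\in\mathbb{N}$. (iii) For every initial distribution $\nu_0$ and every $\ell\in\mathbb{N}$, $\mathrm{KL}(\nu_t\,\|\,\pi^{(\ell)})\le e^{-\lambda t}\,\mathrm{KL}(\nu_0\,\|\,\pi^{(\ell)})$, where $\nu_t$ solves the mean-field SVGD equation with target $\pi^{(\ell)}$ at time $t$, started from $\nu_0$. (iv) $\mathrm{KL}(\pi^{(\ell-1)}\,\|\,\pi^{(\ell)})\le k_2 s^{-\alpha\ell}$ for all $\ell\ge2$. (v) $R_\ell\le k_3 s^{-\alpha\ell}$ for a constant $k_3$, where $R_\ell$ is the remainder defined in the context. Then, for a tolerance $\epsilon>0$, the costs of continuous MLSVGD (with suitably selected level $L$ and integration times $T_1,\dots,T_L$) to have $d_{\mathrm{Hell}}(\mu^{\mathrm{ML}},\pi)\le\epsilon$ can be bounded as $$c_{\mathrm{ML}}^*(\epsilon)\le\frac{c_0s^{2\gamma}}{\lambda\gamma\log(s)}\log\left(s^{\alpha}+\frac{k_2+k_3}{k_1}\right)\left(\frac{\sqrt{2k_1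}}{\epsilon}\right)^{2\gamma/\alpha}.$$
   Context: Let $\Theta\subset\mathbb{R}^d$ be measurable. All distributions are probability measures on $\Theta$ with densities with respect to Lebesgue measure, identified with their densities. The target is $\pi$; $(\pi^{(\ell)})_{\ell\ge1}$ is a sequence of distributions converging weakly to $\pi$; $\mu_0$ is a fixed initial distribution; $c_\ell$ is the cost of evaluating the unnormalized density of $\pi^{(\ell)}$. $\mathrm{KL}(\mu\,\|\,\eta)=\int\mu\log(\mu/\eta)\,d\theta$ and $d_{\mathrm{Hell}}(\mu,\eta)=\sqrt{\tfrac12\int(\sqrt{\mu}-\sqrt{\eta})^2\,d\theta}$. Mean-field SVGD (Stein variational gradient descent) equation with target $\eta$ and kernel $K:\mathbb{R}^d\times\mathbb{R}^d\to\mathbb{R}$ of a reproducing kernel Hilbert space: $$\partial_t\nu_t(\theta)=-\nabla\cdot\Big(\nu_t(\theta)\,\mathbb{E}_{\theta'\sim\nu_t}\big[K(\theta',\theta)\nabla\log\eta(\theta')+\nabla_1K(\theta',\theta)\big]\Big),$$ where $\nabla_1$ is the gradient in the first argument. Continuous MLSVGD (multilevel SVGD) with integration times $T_1,\dots,T_L$: $\mu^{(1)}_{T_1}$ is the solution at time $T_1$ of the mean-field SVGD equation with target $\pi^{(1)}$ started from $\mu_0$; for $\ell\ge2$, $\mu^{(\ell)}_{T_\ell}$ is the solution at time $T_\ell$ with target $\pi^{(\ell)}$ started from $\mu^{(\ell-1)}_{T_{\ell-1}}$. With $L$ levels the output is $\mu^{\mathrm{ML}}=\mu^{(L)}_{T_L}$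 and the cost is $\sum_{\ell=1}^L c_\ell T_\ell$. Remainder: $$R_\ell=\int_{\Theta}\big(\mu^{(\ell-1)}_{T_{\ell-1}}(\theta)-\pi^{(\ell-1)}(\theta)\big)\log\left(\frac{\pi^{(\ell-1)}(\theta)}{\pi^{(\ell)}(\theta)}\right)d\theta.$$
   Formalization: The bound is proved for 0 < ε ≤ ε₀, with ε₀ > 0 depending only on the constants, and ε₀ ≥ √(2k₁) if k₀ ≤ k₁ + (k₂+k₃)s^{-α}; for arbitrary ε > 0 it is false, since it ignores k₀ and tends to 0 as k₁ → 0 (with k₂ = k₁, k₃ = 0) while a fixed positive cost is needed. *)

(* Defs.v *)
From HB Require Import structures.
From mathcomp Require Import all_boot all_order all_algebra.
From mathcomp Require Import all_classical all_reals all_analysis.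

Set Implicit Arguments.
Unset Strict Implicit.
Unset Printing Implicit Defensive.

Import Order.TTheory GRing.Theory Num.Theory.
Import numFieldNormedType.Exports.

Local Open Scope classical_set_scope.
Local Open Scope ring_scope.

(* MathComp-Analysis has Lebesgue measure only on the line. On R^n, n = d.+1,  *)
(* it is obtained here from the outer measure                                *)
(*   A |-> inf { sum_k vol(B_k) | A is covered by the half-open boxes B_k }  *)
(* by Caratheodory's theorem; measurable sets are the Lebesgue-measurable    *)
(* ones.                                                                     *)
Section lebesgue_rV.
Context (R : realType) (d : nat).
Local Notation X := 'rV[R]_d.+1.
Local Open Scope ereal_scope.

Definition box (B : X * X) : set X :=
  [set x : X | forall i, (B.1 ord0 i < x ord0 i <= B.2 ord0 i)%R].

Definition box_volume (B : X * X) : \bar R :=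
  (\prod_i Num.max 0 (B.2 ord0 i - B.1 ord0 i))%R%:E.

Definition lebesgue_outer (A : set X) : \bar R :=
  ereal_inf [set \sum_(k <oo) box_volume (B k) |
              B in [set B : (X * X)^nat | A `<=` \bigcup_k box (B k)]].

Lemma box_volume_ge0 B : 0 <= box_volume B.
Proof. by rewrite lee_fin; apply: prodr_ge0 => i _; rewrite le_max lexx. Qed.

Lemma lebesgue_outer_ge0 A : 0 <= lebesgue_outer A.
Proof.
apply: le_ereal_inf_tmp => _ [B _ <-].
by apply: nneseries_ge0 => n _ _; exact: box_volume_ge0.
Qed.

Lemma lebesgue_outer0 : lebesgue_outer set0 = 0.
Proof.
apply/eqP; rewrite eq_le lebesgue_outer_ge0 andbT.
apply: ereal_inf_lbound; exists (fun=> (0, 0)%R); first exact: sub0set.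
apply: eseries0 => n _ _.
by rewrite /box_volume big_ord_recl /= mxE subrr maxxx mul0r.
Qed.

Lemma le_lebesgue_outer : {homo lebesgue_outer : A B / A `<=` B >-> A <= B}.
Proof.
move=> A B AB; apply/ereal_inf_le_tmp => _ [C BC <-].
by exists C => //; exact: subset_trans BC.
Qed.

Lemma lebesgue_outer_sigma_subadditive : sigma_subadditive lebesgue_outer.
Proof.
move=> A; have [[i ioo]|] := pselect (exists i, lebesgue_outer (A i) = +oo).
  rewrite (eseries_pinfty _ _ ioo) ?leey// => n _.
  by rewrite -ltNye (lt_le_trans _ (lebesgue_outer_ge0 _)).
rewrite -forallNE => Aoo.
suff add2e (e : {posnum R}) : lebesgue_outer (\bigcup_n A n) <=
    \sum_(i <oo) lebesgue_outer (A i) + e%:num%:E.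
  by apply/lee_addgt0Pr => _/posnumP[].
rewrite (le_trans _ (epsilon_trick _ _ _))//; last first.
  by move=> n; exact: lebesgue_outer_ge0.
pose P n (B : (X * X)^nat) := A n `<=` \bigcup_k box (B k) /\
  \sum_(k <oo) box_volume (B k) <=
    lebesgue_outer (A n) + (e%:num / (2 ^ n.+1)%:R)%:E.
have [G PG] : {G : ((X * X)^nat)^nat & forall n, P n (G n)}.
  apply: (@choice _ _ P) => n; rewrite /P /lebesgue_outer.
  set S := (X in ereal_inf X); move infS : (ereal_inf S) => iS.
  case: iS infS => [r Sr|Soo|Soo].
  - have en1 : (0 < e%:num / (2 ^ n.+1)%:R)%R by [].
    have /(lb_ereal_inf_adherent en1) : ereal_inf S \is a fin_num by rewrite Sr.
    move=> [x [B AnB muBx] xS].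
    by exists B; split => //; rewrite muBx -Sr; exact/ltW.
  - by have := Aoo n; rewrite /lebesgue_outer Soo.
  - suff : lbound S 0 by move/le_ereal_inf_tmp; rewrite Soo.
    by move=> /= _ [B AnB <-]; apply: nneseries_ge0 => *; exact: box_volume_ge0.
have muG_ge0 x : 0 <= (box_volume \o uncurry G) x by exact: box_volume_ge0.
apply: (@le_trans _ _ (\esum_(i in setT) (box_volume \o uncurry G) i)).
  apply: ereal_inf_lbound => /=.
  have /card_esym/ppcard_eqP[f] := card_nat2.
  exists (uncurry G \o f).
    move=> t [i _] /(PG i).1 [j _ Bijt]; exists (f^-1%FUN (i, j)) => //=.
    by rewrite invK ?inE.
  rewrite -(esum_pred_image (box_volume \o uncurry G) _ xpredT)
    ?[fun=> _]set_true//.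
  by rewrite image_eq.
rewrite (_ : esum _ _ =
    \sum_(i <oo) \sum_(j <oo ) box_volume (G i j)); last first.
  pose J : nat -> set (nat * nat) := fun i => [set (i, j) | j in setT].
  rewrite (_ : setT = \bigcup_k J k); last first.
    by rewrite predeqE => -[a b]; split => // _; exists a => //; exists b.
  rewrite esum_bigcupT /=; last 2 first.
    - apply/trivIsetP => i j _ _ ij.
      rewrite predeqE => -[n m] /=; split => //= -[] [_] _ [<-{n} _].
      by move=> [m' _] [] /esym/eqP; rewrite (negbTE ij).
    - by move=> /= [n m]; exact: (muG_ge0 (n, m)).
  rewrite -(image_id [set: nat]) -fun_true esum_pred_image//; last first.
    by move=> n _; apply: esum_ge0 => x _; exact: muG_ge0.
  apply: eq_eseriesr => /= j _.
  rewrite -(esum_pred_image (box_volume \o uncurry G) (pair j) predT)//=;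
    first last.
  - by move=> ? ? _ _; exact: (@can_inj _ _ _ snd).
  - by move=> n _; exact: (muG_ge0 (j, n)).
  by congr esum; rewrite predeqE => -[a b]; split; move=> [i _ <-]; exists i.
apply: lee_lim.
- apply: is_cvg_nneseries => n *.
  by apply: nneseries_ge0 => m *; exact: (muG_ge0 (n, m)).
- by apply: is_cvg_nneseries => n *; apply: adde_ge0 => //;
    exact: lebesgue_outer_ge0.
- by near=> n; apply: lee_sum => i _; exact: (PG i).2.
Unshelve. all: by end_near. Qed.

HB.instance Definition _ := isOuterMeasure.Build R X lebesgue_outer
  lebesgue_outer0 lebesgue_outer_ge0 le_lebesgue_outer
  lebesgue_outer_sigma_subadditive.

Let outer := [the {outer_measure set X -> \bar R} of lebesgue_outer].

Definition lebesgue_space := caratheodory_type outer.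

HB.instance Definition _ := Measurable.on lebesgue_space.

Definition lebesgue_rV : set lebesgue_space -> \bar R := lebesgue_outer.

HB.instance Definition _ := isMeasure.Build _ lebesgue_space R lebesgue_rV
  (@caratheodory_measure0 R X outer) (@caratheodory_measure_ge0 R X outer)
  (@caratheodory_measure_sigma_additive R X outer).

End lebesgue_rV.

Arguments lebesgue_space : clear implicits.
Arguments lebesgue_rV : clear implicits.

(* [pdf] is defined on all of R^n and extended by 0 outside of Theta. *)
Record density (R : realType) (d : nat) (Theta : set (lebesgue_space R d)) :=
  Density {
    pdf :> 'rV[R]_d.+1 -> R;
    measurable_pdf :
      measurable_fun [set: lebesgue_space R d] (pdf : lebesgue_space R d -> R);
    pdf_ge0 : forall x, 0 <= pdf x;
    pdf_out : forall x, ~ Theta x -> pdf x = 0;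
    integral_pdf : (\int[lebesgue_rV R d]_(x in Theta) (pdf x)%:E = 1)%E
  }.

Section divergences.
Context (R : realType) (d : nat) (Theta : set (lebesgue_space R d)).
Implicit Types mu eta : density Theta.

(* a log(a/b), with 0 log(0/b) = 0 and a log(a/0) = +oo for a > 0 *)
Definition xlogxy (a b : R) : \bar R :=
  if a == 0 then 0%E else if b == 0 then +oo%E else (a * ln (a / b))%:E.

(* The negative part of the integrand is at most eta, so the integral is     *)
(* always well defined in [0, +oo].                                          *)
Definition KL mu eta : \bar R :=
  (\int[lebesgue_rV R d]_(x in Theta) xlogxy (mu x) (eta x))%E.

Definition dHell mu eta : R :=
  Num.sqrt (2^-1 * \int[lebesgue_rV R d]_(x in Theta)
    (Num.sqrt (mu x) - Num.sqrt (eta x)) ^+ 2).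

Definition weakly_converges (pi_ : nat -> density Theta) (pi : density Theta) :=
  forall f : 'rV[R]_d.+1 -> R, continuous f ->
    (exists M, forall x, `|f x| <= M) ->
    (fun l => \int[lebesgue_rV R d]_(x in Theta) (f x * pi_ l x)) @ \oo -->
      \int[lebesgue_rV R d]_(x in Theta) (f x * pi x).

End divergences.

(* K is the kernel of a reproducing kernel Hilbert space H of functions on X; *)
(* [ev] realizes the elements of H as functions.                              *)
Definition reproducing_kernel (R : realType) (X : Type) (K : X -> X -> R) :=
  exists (H : completeNormedModType R) (ip : H -> H -> R) (ev : H -> X -> R),
  [/\ forall f g, ip f g = ip g f,
      forall (a : R) f g h, ip (a *: f + g) h = a * ip f h + ip g h,
      forall f, ip f f = `|f| ^+ 2,
      injective ev &
      forall x, exists kx : H,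
        ev kx = K x /\ forall f, ev f x = ip f kx].

Section svgd.
Context (R : realType) (d : nat) (Theta : set (lebesgue_space R d)).
Local Notation X := 'rV[R]_d.+1.
Implicit Types (K : X -> X -> R) (eta nu : density Theta).

Definition grad (f : X -> R) (x : X) : X :=
  \row_i 'D_(delta_mx ord0 i) f x.

Definition stein K eta (y x : X) : X :=
  K y x *: grad (fun z => ln (eta z)) y + grad (K^~ x) y.

Definition svgd_velocity K eta nu (x : X) : X :=
  \row_i \int[lebesgue_rV R d]_(y in Theta) (stein K eta y x ord0 i * nu y).

(* The expectation defining the velocity at x makes sense. Gradients are only *)
(* required nu-almost everywhere, so that kernels with a kink on the diagonal *)
(* and targets that are not smooth on the boundary of Theta are allowed.      *)
Definition svgd_velocity_defined K eta nu (x : X) :=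
  {ae lebesgue_rV R d, forall y, nu y != 0 ->
     [/\ 0 < eta y, differentiable (eta : X -> R) y
       & differentiable (K^~ x) y]} /\
  forall i, (lebesgue_rV R d).-integrable Theta
    (fun y => (stein K eta y x ord0 i * nu y)%:E).

Definition test_function (phi : X -> R) :=
  [/\ forall x, differentiable phi x,
      forall i, continuous (fun x => grad phi x ord0 i) &
      compact (closure [set x | phi x != 0])].

Definition svgd_flux K eta nu (phi : X -> R) (x : X) : R :=
  (\sum_i grad phi x ord0 i * svgd_velocity K eta nu x ord0 i) * nu x.

(* Weak (distributional) solution, on [0, +oo[, of                           *)
(*   d/dt nu_t = - div (nu_t * svgd_velocity K eta nu_t),  nu_0 given.       *)
Definition svgd_solution K eta nu0 (nu : R -> density Theta) :=
  [/\ {ae lebesgue_rV R d, forall x, nu 0 x = nu0 x},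
      {ae @lebesgue_measure R, forall t, 0 <= t ->
         {ae lebesgue_rV R d, forall x, nu t x != 0 ->
            svgd_velocity_defined K eta (nu t) x}} &
      forall phi, test_function phi ->
        [/\ {ae @lebesgue_measure R, forall t, 0 <= t ->
               (lebesgue_rV R d).-integrable Theta
                 (fun x => (svgd_flux K eta (nu t) phi x)%:E)},
            forall t, 0 <= t -> (@lebesgue_measure R).-integrable `[0, t]
              (fun r => (\int[lebesgue_rV R d]_(x in Theta)
                            svgd_flux K eta (nu r) phi x)%:E) &
            forall t, 0 <= t ->
              \int[lebesgue_rV R d]_(x in Theta) (phi x * nu t x) =
              \int[lebesgue_rV R d]_(x in Theta) (phi x * nu0 x) +
              \int[@lebesgue_measure R]_(r in `[0, t])
                \int[lebesgue_rV R d]_(x in Theta)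
                   svgd_flux K eta (nu r) phi x]].

(* [flow l nu0 t] is the solution at time t of the mean-field equation with   *)
(* target pi_ l started from nu0. If KL(nu0 || pi_ l) = +oo (e.g. if nu0      *)
(* charges zeros of pi_ l) no solution is required to exist.                  *)
Definition svgd_flow K (pi_ : nat -> density Theta)
    (flow : nat -> density Theta -> R -> density Theta) :=
  forall l nu0, (1 <= l)%N -> (KL nu0 (pi_ l) < +oo)%E ->
    svgd_solution K (pi_ l) nu0 (flow l nu0).

(* mu^(l)_{T_l}, with mu^(0)_{T_0} standing for the initial distribution *)
Fixpoint mlsvgd (flow : nat -> density Theta -> R -> density Theta)
    (mu0 : density Theta) (T : nat -> R) (l : nat) : density Theta :=
  if l is l'.+1 then flow l (mlsvgd flow mu0 T l') (T l) else mu0.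

Definition mlsvgd_cost (c T : nat -> R) (L : nat) : R :=
  \sum_(1 <= l < L.+1) c l * T l.

Definition remainder_integrand flow mu0 (pi_ : nat -> density Theta)
    (T : nat -> R) (l : nat) (x : X) : R :=
  (mlsvgd flow mu0 T l.-1 x - pi_ l.-1 x) * ln (pi_ l.-1 x / pi_ l x).

Definition remainder flow mu0 pi_ T l : R :=
  \int[lebesgue_rV R d]_(x in Theta) remainder_integrand flow mu0 pi_ T l x.

End svgd.

(* Main.v *)
(* Since m ln(m/q) = m ln(m/p) + p ln(p/q) + (m - p) ln(p/q), changing the target
   from pi_(l-1) to pi_l costs
     KL(mu^(l-1) || pi_l) = KL(mu^(l-1) || pi_(l-1)) + KL(pi_(l-1) || pi_l) + R_l.
   If the first term is at most k1 s^(-alpha (l-1)), the sum is at most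
   A k1 s^(-alpha l) with A = s^alpha + (k2 + k3)/k1, and the integration time
   log(A)/lambda brings it down to k1 s^(-alpha l). The first level needs the time
   log(k0 s^alpha/k1)/lambda instead, if that is longer. Choosing L with
   r <= s^L <= s r, r = (sqrt(2 k1)/eps)^(2/alpha), gives
     dHell^2 <= KL(mu^(L) || pi_L) + KL(pi_L || pi) <= 2 k1 s^(-alpha L) <= eps^2,
   and the cost is a geometric sum. *)
Require Import Defs.
From mathcomp Require Import all_boot all_order all_algebra.
From mathcomp Require Import all_classical all_reals all_analysis.
From mathcomp Require Import measurable_realfun ring lra.

Set Implicit Arguments.
Unset Strict Implicit.
Unset Printing Implicit Defensive.

Import Order.TTheory GRing.Theory Num.Theory.
Import numFieldNormedType.Exports.

Local Open Scope classical_set_scope.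
Local Open Scope ring_scope.

(** * Pointwise inequalities for the integrands of divergence and distance *)

Section pointwise.
Variable R : realType.
Implicit Types a b m p q : R.

Lemma xlogxy_fin a b : (b = 0 -> a = 0) -> xlogxy a b = (a * ln (a / b))%:E.
Proof.
move=> ab; rewrite /xlogxy; have [->|a0] := eqVneq a 0; first by rewrite mul0r.
by have [/ab/eqP|//] := eqVneq b 0; rewrite (negPf a0).
Qed.

Lemma xlogxy_fin_num a b : xlogxy a b \is a fin_num -> b = 0 -> a = 0.
Proof. by rewrite /xlogxy; case: eqP => // _; case: eqP. Qed.

Lemma ln_le_subr1 (x : R) : 0 < x -> ln x <= x - 1.
Proof. by move=> x0; rewrite -{1}(subrKC 1 x) le_ln1Dx// ltrBrDr addrC subrr. Qed.

(** With [u = sqrt(b/a)], [a ln(a/b) = -2 a ln u >= 2 a (1 - u) = 2 a - 2 sqrt(a b)], which is the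
    left side expanded. The form with [a - b] split off is kept because that part integrates to 0
    for densities. *)
Lemma xlnx_ge_sqrt a b : 0 <= a -> 0 <= b -> (b = 0 -> a = 0) ->
  a - b + (Num.sqrt a - Num.sqrt b) ^+ 2 <= a * ln (a / b).
Proof.
move=> a0 b0 ab; rewrite sqrrB !sqr_sqrtr//.
move: a0; rewrite le_eqVlt => /predU1P[<-|a0].
  by rewrite sqrtr0 !mul0r mul0rn; lra.
have {}b0 : 0 < b.
  by rewrite lt_def b0 andbT; apply/eqP => /ab a0'; rewrite a0' ltxx in a0.
have sa : 0 < Num.sqrt a by rewrite sqrtr_gt0.
have sb : 0 < Num.sqrt b by rewrite sqrtr_gt0.
have -> : a / b = (Num.sqrt b / Num.sqrt a) ^- 2.
  by rewrite -exprVn invf_div expr_div_n !sqr_sqrtr// ltW.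
rewrite lnV ?posrE ?exprn_gt0 ?divr_gt0// lnXn ?divr_gt0//.
have := ln_le_subr1 (divr_gt0 sb sa).
rewrite -(ler_pM2l a0) mulrBr mulr1 mulrCA.
have -> : a / Num.sqrt a = Num.sqrt a.
  by rewrite -{1}(sqr_sqrtr (ltW a0)) expr2 mulfK// gt_eqF.
by rewrite mulrN mulrnAr mulr2n; lra.
Qed.

Lemma xlogxy_ge_sqrt a b : 0 <= a -> 0 <= b ->
  ((a - b + (Num.sqrt a - Num.sqrt b) ^+ 2)%:E <= xlogxy a b)%E.
Proof.
move=> a0 b0; have [ab|h] := pselect (b = 0 -> a = 0).
  by rewrite xlogxy_fin// lee_fin xlnx_ge_sqrt.
rewrite /xlogxy; have [aE|_] := eqVneq a 0; first by case: h.
by case: eqVneq => [_|/eqP bN0]; [rewrite leey|case: h].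
Qed.

Lemma xlnx_chain m p q : 0 <= m -> 0 <= p -> 0 <= q ->
  (p = 0 -> m = 0) -> (q = 0 -> p = 0) ->
  m * ln (m / q) = m * ln (m / p) + p * ln (p / q) + (m - p) * ln (p / q).
Proof.
move=> m0 p0 q0 pm qp.
have [p0'|pN0] := eqVneq p 0; first by rewrite (pm p0') p0'; ring.
have qN0 : q != 0 by apply: contra_neq pN0.
have [->|mN0] := eqVneq m 0; first by ring.
rewrite !ln_div ?posrE ?lt_def ?m0 ?p0 ?q0 ?mN0 ?pN0 ?qN0//; ring.
Qed.

Lemma sqrtB_chain m p q :
  (Num.sqrt m - Num.sqrt q) ^+ 2 <=
  2 * (Num.sqrt m - Num.sqrt p) ^+ 2 + 2 * (Num.sqrt p - Num.sqrt q) ^+ 2.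
Proof.
by have := sqr_ge0 (Num.sqrt m - 2 * Num.sqrt p + Num.sqrt q); nra.
Qed.

End pointwise.

(** * Kullback-Leibler divergence and Hellinger distance of densities *)

Section KL_theory.
Context (R : realType) (d : nat) (Theta : set (lebesgue_space R d)).
Hypothesis mTheta : measurable Theta.
Implicit Types mu eta nu : density Theta.
Local Notation lam := (lebesgue_rV R d).

(* Junk values make this 0, rather than +oo, where eta vanishes and mu does not. *)
Definition xlnx mu eta (x : 'rV[R]_d.+1) : R := mu x * ln (mu x / eta x).

Definition abs_cont mu eta :=
  {ae lam, forall x, Theta x -> eta x = 0 -> mu x = 0}.

Lemma measurable_density mu : measurable_fun Theta (mu : lebesgue_space R d -> R).
Proof. exact: measurable_funTS (measurable_pdf mu). Qed.

Lemma integrable_density mu : lam.-integrable Theta (fun x => (mu x)%:E).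
Proof.
apply/integrableP; split; first exact/measurable_EFinP/measurable_density.
under eq_integral do rewrite gee0_abs ?lee_fin ?pdf_ge0//.
by rewrite integral_pdf ltry.
Qed.

Lemma measurable_xlnx mu eta :
  measurable_fun Theta (xlnx mu eta : lebesgue_space R d -> R).
Proof.
apply: measurable_funM; first exact: measurable_density.
apply: (measurableT_comp (@measurable_ln R)).
apply: measurable_funM; first exact: measurable_density.
(* The inverse becomes a real power, a measurable function; the two also agree where [eta] vanishes,
   both being 0 there. *)
rewrite (_ : (fun x => _) = fun x => eta x `^ (-1)).
  exact: (measurableT_comp (measurable_powR (-1)) (measurable_density eta)).
by apply/funext => x; rewrite powR_inv1// pdf_ge0.
Qed.

Definition sqrt_gap mu eta (x : 'rV[R]_d.+1) : R :=
  (Num.sqrt (mu x) - Num.sqrt (eta x)) ^+ 2.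

Lemma measurable_sqrt_gap mu eta :
  measurable_fun Theta (sqrt_gap mu eta : lebesgue_space R d -> R).
Proof.
have msqrt nu :
    measurable_fun Theta (fun x : lebesgue_space R d => Num.sqrt (nu x)).
  apply: (measurableT_comp _ (measurable_density nu)).
  exact: (continuous_measurable_fun (@sqrt_continuous R)).
exact/measurable_funX/measurable_funB.
Qed.

Lemma measurable_xlogxy mu eta : measurable_fun Theta
  (fun x : lebesgue_space R d => xlogxy (mu x) (eta x)).
Proof.
have m0 nu : measurable_fun Theta (fun x : lebesgue_space R d => nu x == 0).
  by apply: measurable_fun_eqr => //; exact: measurable_density.
rewrite (_ : (fun x => _) = fun x =>
    if ~~ (mu x == 0) && (eta x == 0) then +oo%E else (xlnx mu eta x)%:E).
  apply: measurable_fun_if => //.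
    by apply: measurable_and => //; apply: measurable_neg.
  apply: (@measurable_funS _ _ _ _ Theta) => //.
  exact/measurable_EFinP/measurable_xlnx.
apply/funext => x; rewrite /xlogxy /xlnx.
by have [->|] := eqVneq (mu x) 0; rewrite ?mul0r.
Qed.

(** By [xlogxy_ge_sqrt] the integrand is at least [- eta], so its negative part has a finite
    integral. An infinite positive part would then make [KL mu eta] infinite. *)
Lemma KL_integrable mu eta : (KL mu eta < +oo)%E ->
  lam.-integrable Theta (fun x => xlogxy (mu x) (eta x)).
Proof.
pose f (x : lebesgue_space R d) := xlogxy (mu x) (eta x).
have mf : measurable_fun Theta f by exact: measurable_xlogxy.
have fneg : (\int[lam]_(x in Theta) f^\- x < +oo)%E.
  apply: (@le_lt_trans _ _ (\int[lam]_(x in Theta) (eta x)%:E)%E).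
    apply: ge0_le_integral => //.
    - exact: measurable_funeneg.
    - exact/measurable_EFinP/measurable_density.
    - move=> x _; rewrite funenegE ge_max lee_fin pdf_ge0 andbT leeNl.
      apply: le_trans (xlogxy_ge_sqrt (pdf_ge0 mu x) (pdf_ge0 eta x)).
      by rewrite -EFinN lee_fin addrAC lerDr addr_ge0 ?sqr_ge0 ?pdf_ge0.
  by rewrite integral_pdf ltry.
rewrite /KL integralE => KLoo; apply/integrableP; split => //.
rewrite -[fun x => _]/(abse \o f) fune_abse ge0_integralD//; last 2 first.
- exact: measurable_funepos.
- exact: measurable_funeneg.
rewrite lte_add_pinfty//; move: KLoo; rewrite -/f.
case: (\int[lam]_(x in Theta) f^\+ x)%E => [r|//|//]; first by rewrite ltry.
by move: fneg; case: (\int[lam]_(x in Theta) f^\- x)%E.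
Qed.

Lemma KL_abs_cont mu eta : (KL mu eta < +oo)%E -> abs_cont mu eta.
Proof.
move=> /KL_integrable/(integrable_ae mTheta); apply: filterS => x h Tx.
exact/xlogxy_fin_num/h.
Qed.

Let xlogxy_ae_eq mu eta : abs_cont mu eta ->
  ae_eq lam Theta (fun x => xlogxy (mu x) (eta x)) (EFin \o xlnx mu eta).
Proof. by apply: filterS => x h Tx; rewrite xlogxy_fin//; exact: h. Qed.

Lemma KL_xlnx mu eta : abs_cont mu eta ->
  KL mu eta = (\int[lam]_(x in Theta) (xlnx mu eta x)%:E)%E.
Proof.
move=> /xlogxy_ae_eq; apply: ae_eq_integral => //; first exact: measurable_xlogxy.
exact/measurable_EFinP/measurable_xlnx.
Qed.

Lemma integrable_xlnx mu eta : (KL mu eta < +oo)%E ->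
  lam.-integrable Theta (EFin \o xlnx mu eta).
Proof.
move=> KLoo; have := KL_integrable KLoo.
move=> /integrableP[_ foo]; apply/integrableP; split.
  exact/measurable_EFinP/measurable_xlnx.
rewrite (le_lt_trans _ foo)// le_eqVlt; apply/orP; left; apply/eqP.
apply: ae_eq_integral => //.
- by apply/measurable_EFinP/measurableT_comp => //; exact: measurable_xlnx.
- by apply: measurableT_comp => //; exact: measurable_xlogxy.
- by apply: filterS (KL_abs_cont KLoo) => x h Tx; rewrite xlogxy_fin//; exact: h.
Qed.

Lemma integrable_sqrt_gap mu eta :
  lam.-integrable Theta (EFin \o sqrt_gap mu eta).
Proof.
apply: (@le_integrable _ _ _ lam Theta mTheta _ (fun x => (mu x)%:E + (eta x)%:E)%E) => //.
- exact/measurable_EFinP/measurable_sqrt_gap.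
- move=> x _; rewrite /sqrt_gap /= lee_fin !ger0_norm ?sqr_ge0 ?addr_ge0 ?pdf_ge0//.
  rewrite sqrrB !sqr_sqrtr ?pdf_ge0// lerD2r lerBlDr lerDl.
  by rewrite mulrn_wge0// mulr_ge0.
- by apply: integrableD => //; exact: integrable_density.
Qed.

Lemma sqrt_gap_le_KL mu eta :
  (\int[lam]_(x in Theta) (sqrt_gap mu eta x)%:E <= KL mu eta)%E.
Proof.
have [KLoo|] := ltP (KL mu eta) +oo%E; last by rewrite leye_eq => /eqP ->; rewrite leey.
have im := integrable_density mu; have ie := integrable_density eta.
have ig := integrable_sqrt_gap mu eta.
(* Adding [mu - eta] leaves the integral unchanged, since both densities have mass 1, and puts the
   integrand below [xlogxy] pointwise. *)
pose f x := ((mu x)%:E - (eta x)%:E + (sqrt_gap mu eta x)%:E)%E.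
have if_ : lam.-integrable Theta f.
  by apply: integrableD => //; apply: integrableB.
have -> : (\int[lam]_(x in Theta) (sqrt_gap mu eta x)%:E =
    \int[lam]_(x in Theta) f x)%E.
  rewrite integralD//; last exact: integrableB.
  by rewrite integralB// !integral_pdf subee// add0e.
apply: le_integral => //; first exact: KL_integrable.
by move=> x _; rewrite /f -EFinB -EFinD xlogxy_ge_sqrt// pdf_ge0.
Qed.

Lemma KL_ge0 mu eta : (0 <= KL mu eta)%E.
Proof.
apply: le_trans (sqrt_gap_le_KL mu eta).
by apply: integral_ge0 => x _; rewrite lee_fin sqr_ge0.
Qed.

(** The integrated form of [xlnx_chain]. Finiteness of the two divergences gives the almost
    everywhere absolute continuity that the identity needs; integrability of the last term allows
    the integral to be split. *)
Lemma KL_chain mu nu eta (a b : R) :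
  (KL mu nu <= a%:E)%E -> (KL nu eta <= b%:E)%E ->
  lam.-integrable Theta
    (fun x => ((mu x - nu x) * ln (nu x / eta x))%:E) ->
  (KL mu eta <= (a + b +
     \int[lam]_(x in Theta) ((mu x - nu x) * ln (nu x / eta x)))%:E)%E.
Proof.
move=> KLa KLb; set r := (X in integrable _ _ X); move=> ir.
have KL1 := le_lt_trans KLa (ltry _); have KL2 := le_lt_trans KLb (ltry _).
have ac1 := KL_abs_cont KL1; have ac2 := KL_abs_cont KL2.
have i1 := integrable_xlnx KL1; have i2 := integrable_xlnx KL2.
have ac3 : abs_cont mu eta.
  by apply: filterS2 ac1 ac2 => x h1 h2 Tx etax; apply: h1 => //; exact: h2.
have -> : KL mu eta = (\int[lam]_(x in Theta)
    ((xlnx mu nu x)%:E + (xlnx nu eta x)%:E + r x))%E.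
  rewrite KL_xlnx//; apply: ae_eq_integral => //.
  - exact/measurable_EFinP/measurable_xlnx.
  - by apply: (measurable_int lam); apply: integrableD => //; exact: integrableD.
  - apply: filterS2 ac1 ac2 => x h1 h2 Tx.
    rewrite /r -!EFinD; congr EFin; apply: xlnx_chain; rewrite ?pdf_ge0//.
      exact: h1.
    exact: h2.
rewrite integralD//; last exact: integrableD.
rewrite integralD// -!KL_xlnx// !EFinD leeD//; first exact: leeD.
by rewrite /Rintegral fineK// integrable_fin_num.
Qed.

(* (x + y)^2 <= 2 x^2 + 2 y^2 replaces the triangle inequality: it loses nothing
   when the two bounds a and b coincide. *)
Lemma dHell_le_KL mu nu eta (a b : R) :
  (KL mu nu <= a%:E)%E -> (KL nu eta <= b%:E)%E ->
  dHell mu eta <= Num.sqrt (a + b).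
Proof.
move=> KLa KLb; apply: ler_wsqrtr.
have gap_le m1 m2 r : (KL m1 m2 <= r%:E)%E ->
    \int[lam]_(x in Theta) sqrt_gap m1 m2 x <= r.
  move=> /(le_trans (sqrt_gap_le_KL m1 m2)); rewrite -lee_fin /Rintegral fineK//.
  exact/integrable_fin_num/integrable_sqrt_gap.
have i1 := integrable_sqrt_gap mu nu; have i2 := integrable_sqrt_gap nu eta.
have iZ f : lam.-integrable Theta (EFin \o f) ->
    lam.-integrable Theta (EFin \o (fun x => 2 * f x)).
  exact: (integrableZl mTheta 2).
have : \int[lam]_(x in Theta) sqrt_gap mu eta x <=
    \int[lam]_(x in Theta) (2 * sqrt_gap mu nu x + 2 * sqrt_gap nu eta x).
  apply: le_Rintegral => //; first exact: integrable_sqrt_gap.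
    exact: (integrableD mTheta (iZ _ i1) (iZ _ i2)).
  by move=> x _; exact: sqrtB_chain.
rewrite RintegralD//; [|exact: iZ|exact: iZ]; rewrite !RintegralZl//.
move=> /le_trans gap; rewrite ler_pdivrMl// mulrDr; apply: gap.
by apply: lerD; rewrite ler_pM2l//; exact: gap_le.
Qed.

End KL_theory.

(** * Exponential, logarithmic and geometric estimates *)

Section real_bounds.
Variable R : realType.
Implicit Types s x D alpha gamma g : R.

Lemma mul_ln_lt_powR s gamma : 1 < s -> 0 < gamma ->
  gamma * ln s < s `^ gamma - 1.
Proof.
move=> s1 gamma0; have s0 : 0 < s := lt_trans ltr01 s1.
rewrite ltrBrDl /powR (negPf (lt0r_neq0 s0)) expR_gt1Dx//.
by rewrite mulf_neq0 ?gt_eqF// ln_gt0.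
Qed.

Lemma powR_muln s x n : 0 <= s -> s `^ (x * n%:R) = (s `^ x) ^+ n.
Proof. by move=> s0; rewrite powRrM powR_mulrn ?powR_ge0. Qed.

Lemma exists_level s D : 1 < s -> 1 <= D ->
  exists2 L, (1 <= L)%N & D <= s ^+ L <= s * D.
Proof.
move=> s1 D1; have s0 : 0 < s := lt_trans ltr01 s1.
have D0 : 0 < D := lt_le_trans ltr01 D1.
have lns := ln_gt0 s1.
have y0 : 0 <= ln D / ln s by rewrite divr_ge0 ?ln_ge0// ltW.
(* One more than the integer part of [log_s D]: hence [s ^+ L] exceeds [D] while the preceding power
   does not. *)
exists (Num.truncn (ln D / ln s)).+1 => //.
have /andP[Ly yL] := truncn_itv y0.
rewrite exprS ler_pM2l//; apply/andP; split.
  rewrite -exprS -ler_ln ?posrE ?exprn_gt0// lnXn// -mulr_natl.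
  by rewrite -ler_pdivrMr// ltW.
rewrite -ler_ln ?posrE ?exprn_gt0// lnXn// -mulr_natl.
by rewrite -ler_pdivlMr.
Qed.

Lemma geometric_sum_le g n : 1 < g ->
  \sum_(1 <= l < n.+1) g ^+ l <= g ^+ n * g / (g - 1).
Proof.
move=> g1; have g10 : 0 < g - 1 by rewrite subr_gt0.
rewrite ler_pdivlMr// mulr_suml.
have -> : \sum_(1 <= l < n.+1) g ^+ l * (g - 1) =
    \sum_(1 <= l < n.+1) (g ^+ l.+1 - g ^+ l).
  by apply: eq_bigr => l _; rewrite mulrBr mulr1 exprSr.
by rewrite telescope_sumr// exprSr gerBl expr1 (le_trans _ (ltW g1)).
Qed.

(** Makes exponential decay explicit: at time [k0 / b / lambda] the bound [k0 exp(- lambda t)] is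
    already below [b]. *)
Lemma expRN_lt_inv x : 0 < x -> expR (- x) < x^-1.
Proof.
move=> x0; rewrite expRN ltf_pV2 ?posrE ?expR_gt0//.
by apply: lt_le_trans (expR_ge1Dx x); rewrite ltrDr.
Qed.

End real_bounds.

(** * Integration times, admissible tolerances and the resulting cost *)

Section schedule.
Context (R : realType) (c0 gamma alpha k0 k1 k2 k3 lambda s : R).
Hypotheses (c0_gt0 : 0 < c0) (gamma_gt0 : 0 < gamma) (alpha_gt0 : 0 < alpha)
  (k0_gt0 : 0 < k0) (k1_gt0 : 0 < k1) (lambda_gt0 : 0 < lambda) (s_gt1 : 1 < s).

Let s_gt0 : 0 < s. Proof. exact: lt_trans s_gt1. Qed.

Definition contraction : R := s `^ alpha + (k2 + k3) / k1.

Definition level_time : R := ln contraction / lambda.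

Definition first_time : R :=
  Num.max level_time (ln (k0 * s `^ alpha / k1) / lambda).

Definition schedule (l : nat) : R := if l == 1%N then first_time else level_time.

(* The bound on the geometric sum, 1 / (s^gamma - 1) <= 1 / (gamma log s), is
   strict; this gain pays for the part of the first integration time that exceeds
   the common one. *)
Definition cost_gain : R := (gamma * ln s)^-1 - (s `^ gamma - 1)^-1.

(** The value that [E = (sqrt(2 k1) / eps)^(2 gamma / alpha)] must reach for the gain to cover the
    longer first level. *)
Definition overhead : R :=
  (first_time - level_time) / (level_time * s `^ gamma * cost_gain).

(** The largest [eps] with [E >= max 1 overhead], solved for [eps]. The 1 in the maximum keeps
    [eps <= sqrt(2 k1)], as the choice of the level requires. *)
Definition tolerance0 : R :=
  Num.sqrt (2 * k1) / (Num.max 1 overhead) `^ (alpha / (2 * gamma)).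

Lemma cost_gain_gt0 : 0 < cost_gain.
Proof.
have h := mul_ln_lt_powR s_gt1 gamma_gt0.
have h0 : 0 < gamma * ln s by rewrite mulr_gt0// ln_gt0.
by rewrite subr_gt0 ltf_pV2 ?posrE// (lt_trans h0).
Qed.

Lemma tolerance0_gt0 : 0 < tolerance0.
Proof.
by rewrite divr_gt0 ?sqrtr_gt0 ?mulr_gt0// powR_gt0// lt_max ltr01.
Qed.

Lemma tolerance0_le : tolerance0 <= Num.sqrt (2 * k1).
Proof.
have max1 : 1 <= Num.max 1 overhead by rewrite le_max lexx.
rewrite ler_pdivrMr ?powR_gt0 ?(lt_le_trans ltr01)//.
rewrite ler_pMr ?sqrtr_gt0 ?mulr_gt0//.
rewrite -[leLHS](powRr0 (Num.max 1 overhead)) ler_powR//.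
by rewrite divr_ge0 ?mulr_ge0// ltW.
Qed.

(** The hypothesis amounts to [k0 s^alpha / k1 <= contraction]: the first level then needs no extra
    time, and [overhead] is 0. *)
Lemma tolerance0_eq : k0 <= k1 + (k2 + k3) * s `^ (- alpha) ->
  tolerance0 = Num.sqrt (2 * k1).
Proof.
move=> k0_le; have sa : 0 < s `^ alpha by rewrite powR_gt0.
have le_contr : k0 * s `^ alpha / k1 <= contraction.
  rewrite ler_pdivrMr// /contraction mulrDl divfK ?gt_eqF//.
  move: k0_le; rewrite powRN -(ler_pM2r sa) mulrDl divfK ?gt_eqF//.
  by rewrite [k1 * _]mulrC.
have b0 : 0 < k0 * s `^ alpha / k1 by rewrite divr_gt0 ?mulr_gt0.
rewrite /tolerance0 /overhead (_ : first_time = level_time).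
  by rewrite subrr mul0r (max_idPl ler01) powR1 divr1.
apply/max_idPl; rewrite ler_pM2r ?invr_gt0// ler_ln ?posrE//.
exact: lt_le_trans le_contr.
Qed.

Hypothesis k23_ge0 : 0 <= k2 + k3.

Lemma contraction_gt1 : 1 < contraction.
Proof.
apply: (@lt_le_trans _ _ (s `^ alpha)); last by rewrite lerDl divr_ge0// ltW.
rewrite -subr_gt0 (lt_trans _ (mul_ln_lt_powR s_gt1 alpha_gt0))//.
by rewrite mulr_gt0// ln_gt0.
Qed.

Lemma level_time_gt0 : 0 < level_time.
Proof. by rewrite divr_gt0// ln_gt0// contraction_gt1. Qed.

Lemma schedule_gt0 l : 0 < schedule l.
Proof.
by rewrite /schedule; case: ifP => _; rewrite ?lt_max level_time_gt0.
Qed.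

Lemma expR_level_time : expR (- (lambda * level_time)) = contraction^-1.
Proof.
by rewrite /level_time mulrC divfK ?gt_eqF// expRN lnK// posrE
  (lt_trans ltr01 contraction_gt1).
Qed.

Lemma expR_first_time : expR (- (lambda * first_time)) * k0 <= k1 * s `^ (- alpha).
Proof.
have b0 : 0 < k0 * s `^ alpha / k1 by rewrite divr_gt0 ?mulr_gt0 ?powR_gt0.
have h : ln (k0 * s `^ alpha / k1) <= lambda * first_time.
  by rewrite [leRHS]mulrC -ler_pdivrMr// le_max lexx orbT.
rewrite -ler_pdivlMr//; apply: (@le_trans _ _ (expR (- ln (k0 * s `^ alpha / k1)))).
  by rewrite ler_expR lerN2.
by rewrite expRN lnK ?posrE// powRN invf_div invfM mulrA mulrAC.
Qed.

Lemma schedule_cost (c : nat -> R) (eps : R) (L : nat) :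
  (forall l, (1 <= l)%N -> c l <= c0 * s `^ (gamma * l%:R)) ->
  0 < eps <= tolerance0 -> (1 <= L)%N ->
  s ^+ L <= s * (Num.sqrt (2 * k1) / eps) `^ (2 / alpha) ->
  mlsvgd_cost c schedule L <=
    c0 * s `^ (2 * gamma) / (lambda * gamma * ln s) * ln contraction *
    (Num.sqrt (2 * k1) / eps) `^ (2 * gamma / alpha).
Proof.
move=> c_le /andP[eps0 eps_le] L1 sL.
set r := Num.sqrt (2 * k1) / eps; set E := r `^ _.
have r0 : 0 <= r by rewrite divr_ge0 ?sqrtr_ge0 ?ltW.
pose g := s `^ gamma.
have lng := mul_ln_lt_powR s_gt1 gamma_gt0.
have lng0 : 0 < gamma * ln s by rewrite mulr_gt0// ln_gt0.
have g10 : 0 < g - 1 := lt_trans lng0 lng.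
have g1 : 1 < g by rewrite -subr_gt0.
have g0 : 0 < g := lt_trans ltr01 g1.
have gL : g ^+ L <= g * E.
  rewrite -powR_muln ?(ltW s_gt0)// [gamma * _]mulrC powRrM powR_mulrn ?(ltW s_gt0)//.
  have : (s ^+ L) `^ gamma <= (s * r `^ (2 / alpha)) `^ gamma.
    by apply: ge0_ler_powR sL; rewrite ?nnegrE ?exprn_ge0 ?mulr_ge0 ?powR_ge0 ?ltW.
  by rewrite powRM ?powR_ge0 ?(ltW s_gt0)// -powRrM mulrAC.
(* The only place where smallness of [eps] enters the cost: [eps <= tolerance0] bounds [r] from
   below, and raising to the power [2 gamma / alpha] undoes the exponent in [tolerance0]. *)
have EM : overhead <= E.
  have M0 : 0 < Num.max 1 overhead by rewrite lt_max ltr01.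
  have p0 : 0 < alpha / (2 * gamma) by rewrite divr_gt0 ?mulr_gt0.
  have le_r : (Num.max 1 overhead) `^ (alpha / (2 * gamma)) <= r.
    by rewrite ler_pdivlMr// mulrC -ler_pdivlMr ?powR_gt0.
  have q0 : 0 <= 2 * gamma / alpha by rewrite divr_ge0 ?mulr_ge0 ?ltW.
  have := ge0_ler_powR q0 (powR_ge0 _ _) r0 le_r; rewrite -powRrM.
  rewrite (_ : _ * (2 * gamma / alpha) = 1); last by field; rewrite !gt_eqF.
  rewrite (powRr1 (ltW M0)).
  by apply: le_trans; rewrite le_max lexx orbT.
have tau0 := level_time_gt0; have gain0 := cost_gain_gt0.
have firstE : first_time - level_time = overhead * (level_time * g * cost_gain).
  by rewrite /overhead -/g divfK// gt_eqF// (mulr_gt0 (mulr_gt0 tau0 g0) gain0).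
apply: (@le_trans _ _ (\sum_(1 <= l < L.+1) c0 * g ^+ l * schedule l)).
  apply: ler_sum_nat => l /andP[l1 _]; rewrite ler_pM2r ?schedule_gt0//.
  by rewrite -powR_muln ?(ltW s_gt0)// c_le.
(* The excess of the first time is split off, so that all levels share [level_time] in the geometric
   sum. *)
have -> : \sum_(1 <= l < L.+1) c0 * g ^+ l * schedule l =
    c0 * g * (first_time - level_time) +
    c0 * level_time * \sum_(1 <= l < L.+1) g ^+ l.
  rewrite big_ltn// [in RHS]big_ltn// /schedule eqxx expr1.
  rewrite (_ : \sum_(2 <= l < L.+1) _ =
     c0 * level_time * \sum_(2 <= l < L.+1) g ^+ l); first by ring.
  rewrite mulr_sumr; apply: eq_big_nat => l /andP[l2 _].
  by rewrite gtn_eqF// mulrAC.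
have sum_le : \sum_(1 <= l < L.+1) g ^+ l <= g * E * (g / (g - 1)).
  apply: le_trans (geometric_sum_le L g1) _; rewrite -mulrA.
  by rewrite ler_pM2r// divr_gt0.
apply: (@le_trans _ _ (c0 * g * (E * (level_time * g * cost_gain)) +
    c0 * level_time * (g * E * (g / (g - 1))))).
  apply: lerD; rewrite ler_pM2l ?(mulr_gt0 c0_gt0)//.
  by rewrite firstE ler_pM2r// (mulr_gt0 (mulr_gt0 tau0 g0) gain0).
(* Equality holds: [cost_gain] plus [1 / (g - 1)] is exactly [1 / (gamma ln s)]. *)
rewrite le_eqVlt; apply/orP; left; apply/eqP.
rewrite /cost_gain -/g [2 * gamma]mulrC powRrM powR_mulrn ?powR_ge0// -/g.
rewrite /level_time; field.
by rewrite !gt_eqF// ln_gt0.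
Qed.

End schedule.

(** * Propagation of the divergence bound through the levels *)

Section mlsvgd_error.
Context (R : realType) (d : nat) (Theta : set (lebesgue_space R d)).
Hypothesis mTheta : measurable Theta.
Context (alpha k0 k1 k2 k3 lambda s : R) (pi_ : nat -> density Theta)
  (mu0 : density Theta) (flow : nat -> density Theta -> R -> density Theta).
Hypotheses (alpha_gt0 : 0 < alpha) (k0_gt0 : 0 < k0) (k1_gt0 : 0 < k1)
  (lambda_gt0 : 0 < lambda) (s_gt1 : 1 < s)
  (KL_init : forall l, (1 <= l)%N -> (KL mu0 (pi_ l) <= k0%:E)%E)
  (KL_decay : forall (l : nat) (nu0 : density Theta) (t : R),
    (1 <= l)%N -> 0 <= t ->
    (KL (flow l nu0 t) (pi_ l) <=
      (expR (- (lambda * t)))%:E * KL nu0 (pi_ l))%E)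
  (KL_levels : forall l, (2 <= l)%N ->
    (KL (pi_ l.-1) (pi_ l) <= (k2 * s `^ (- (alpha * l%:R)))%:E)%E)
  (R_bound : forall (T : nat -> R) l, (forall j, 0 < T j) -> (2 <= l)%N ->
    (lebesgue_rV R d).-integrable Theta
      (fun x => (remainder_integrand flow mu0 pi_ T l x)%:E) /\
    remainder flow mu0 pi_ T l <= k3 * s `^ (- (alpha * l%:R))).

Let KL_flow l nu0 t (a : R) : (1 <= l)%N -> 0 <= t ->
  (KL nu0 (pi_ l) <= a%:E)%E ->
  (KL (flow l nu0 t) (pi_ l) <= (expR (- (lambda * t)) * a)%:E)%E.
Proof.
move=> l1 t0 KLa; apply: le_trans (KL_decay nu0 l1 t0) _.
by rewrite EFinM lee_wpmul2l// lee_fin expR_ge0.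
Qed.

(** The change of target, for arbitrary positive times: it serves both the constant times of
    [level_gap_ge0] and the actual schedule. *)
Let KL_next T l (a : R) : (forall j, 0 < T j) -> (1 <= l)%N ->
  (KL (mlsvgd flow mu0 T l) (pi_ l) <= a%:E)%E ->
  (KL (mlsvgd flow mu0 T l) (pi_ l.+1) <=
    (a + (k2 + k3) * s `^ (- (alpha * l.+1%:R)))%:E)%E.
Proof.
move=> T0 l1 KLa; have [iR Rle] := @R_bound T l.+1 T0 l1.
apply: le_trans (KL_chain mTheta KLa (@KL_levels l.+1 l1) iR) _.
by rewrite lee_fin mulrDl addrA lerD2l.
Qed.

(* As the first integration time tends to infinity, KL(mu^(1) || pi^(2)), which
   is nonnegative, is bounded by (k2 + k3) s^(-2 alpha) + o(1). *)
Lemma level_gap_ge0 : 0 <= k2 + k3.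
Proof.
rewrite leNgt; apply/negP => k23.
pose b := - ((k2 + k3) * s `^ (- (alpha * 2%:R))).
have b0 : 0 < b.
  by rewrite oppr_gt0 nmulr_rlt0// powR_gt0// (lt_trans ltr01).
pose t := k0 / b / lambda; have t0 : 0 < t by rewrite !divr_gt0.
have := KL_next (T := fun=> t) (fun=> t0) (leqnn 1)
  (KL_flow (leqnn 1) (ltW t0) (KL_init (leqnn 1))).
move=> /(le_trans (KL_ge0 mTheta _ _)); rewrite lee_fin.
have := expRN_lt_inv (mulr_gt0 lambda_gt0 t0).
have -> : (lambda * t)^-1 = b / k0.
  by rewrite /t mulrC divfK ?gt_eqF// invf_div.
by rewrite ltr_pdivlMr// /b; lra.
Qed.

Let T := schedule alpha k0 k1 k2 k3 lambda s.

Lemma KL_mlsvgd l : (1 <= l)%N ->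
  (KL (mlsvgd flow mu0 T l) (pi_ l) <= (k1 * s `^ (- (alpha * l%:R)))%:E)%E.
Proof.
move=> l1; have k23 := level_gap_ge0.
have T0 j : 0 < T j by exact: schedule_gt0.
have s0 : 0 < s := lt_trans ltr01 s_gt1.
elim: l l1 => // -[_ _|l IHl _].
  apply: le_trans (KL_flow _ (ltW (T0 1%N)) (KL_init _)) _ => //.
  by rewrite lee_fin mulr1 expR_first_time.
apply: le_trans (KL_flow _ (ltW (T0 l.+2)) (KL_next T0 _ (IHl _))) _ => //.
rewrite lee_fin [T _]/(level_time _ _ _ _ _ _) expR_level_time//.
rewrite ler_pdivrMl ?(lt_trans ltr01 (contraction_gt1 _ _ _ _))//.
rewrite le_eqVlt; apply/orP; left; apply/eqP.
(* Passing to the next exponent produces the summand [s^alpha] of [contraction], which the decay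
   over [level_time] cancels exactly. *)
have -> : s `^ (- (alpha * l.+1%:R)) = s `^ alpha * s `^ (- (alpha * l.+2%:R)).
  rewrite -powRD; last by rewrite (gt_eqF s0) implybT.
  by congr (_ `^ _); rewrite -[l.+2]addn1 natrD; ring.
by rewrite /contraction; field; rewrite gt_eqF.
Qed.

End mlsvgd_error.

(** The threshold [eps0] is chosen before the dimension, the densities and the flow, so it depends
    on the constants only. It absorbs the dependence of the first integration time on [k0], which
    does not appear in the cost bound. *)
Theorem proposition3 (R : realType) (c0 gamma alpha k0 k1 k2 k3 lambda s : R)
  (c0_gt0 : 0 < c0) (gamma_gt0 : 0 < gamma) (alpha_gt0 : 0 < alpha)
  (k0_gt0 : 0 < k0) (k1_gt0 : 0 < k1) (k2_gt0 : 0 < k2)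
  (lambda_gt0 : 0 < lambda) (s_gt1 : 1 < s) :
  exists eps0 : R,
  [/\ 0 < eps0,
      k0 <= k1 + (k2 + k3) * s `^ (- alpha) -> Num.sqrt (2 * k1) <= eps0 &
  forall (d : nat) (Theta : set (lebesgue_space R d)) (mTheta : measurable Theta)
    (pi_ : nat -> density Theta) (pi : density Theta)
    (pi_cvg : weakly_converges pi_ pi)
    (mu0 : density Theta) (c : nat -> R)
    (K : 'rV[R]_d.+1 -> 'rV[R]_d.+1 -> R) (K_rkhs : reproducing_kernel K)
    (flow : nat -> density Theta -> R -> density Theta)
    (flowP : svgd_flow K pi_ flow)
    (cost_bound : forall l, (1 <= l)%N -> c l <= c0 * s `^ (gamma * l%:R))
    (KL_init : forall l, (1 <= l)%N -> (KL mu0 (pi_ l) <= k0%:E)%E)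
    (KL_target : forall l, (1 <= l)%N ->
      (KL (pi_ l) pi <= (k1 * s `^ (- (alpha * l%:R)))%:E)%E)
    (KL_decay : forall (l : nat) (nu0 : density Theta) (t : R), (1 <= l)%N -> 0 <= t ->
      (KL (flow l nu0 t) (pi_ l) <=
         (expR (- (lambda * t)))%:E * KL nu0 (pi_ l))%E)
    (KL_levels : forall l, (2 <= l)%N ->
      (KL (pi_ l.-1) (pi_ l) <= (k2 * s `^ (- (alpha * l%:R)))%:E)%E)
    (R_bound : forall (T : nat -> R) l, (forall j, 0 < T j) -> (2 <= l)%N ->
      (lebesgue_rV R d).-integrable Theta
        (fun x => (remainder_integrand flow mu0 pi_ T l x)%:E) /\
      remainder flow mu0 pi_ T l <= k3 * s `^ (- (alpha * l%:R)))
    (eps : R), 0 < eps <= eps0 ->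
    exists (L : nat) (T : nat -> R),
      [/\ (1 <= L)%N,
          forall l, 0 < T l,
          dHell (mlsvgd flow mu0 T L) pi <= eps &
          mlsvgd_cost c T L <=
            c0 * s `^ (2 * gamma) / (lambda * gamma * ln s) *
            ln (s `^ alpha + (k2 + k3) / k1) *
            (Num.sqrt (2 * k1) / eps) `^ (2 * gamma / alpha)]].
Proof.
have s_gt0 : 0 < s := lt_trans ltr01 s_gt1.
exists (tolerance0 gamma alpha k0 k1 k2 k3 lambda s); split.
- exact: tolerance0_gt0.
- by move=> k0_le; rewrite tolerance0_eq.
move=> d Theta mTheta pi_ pi _ mu0 c K _ flow _ cost_bound KL_init KL_target
  KL_decay KL_levels R_bound eps /andP[eps_gt0 eps_le].
(* The sign of [k3] is not prescribed; this inequality makes [contraction] exceed 1 and the times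
   positive. *)
have k23 := level_gap_ge0 mTheta k0_gt0 lambda_gt0 s_gt1 KL_init KL_decay
  KL_levels R_bound.
set r := Num.sqrt (2 * k1) / eps.
have sqrt_k1 : 0 < Num.sqrt (2 * k1) by rewrite sqrtr_gt0 mulr_gt0.
have r_gt0 : 0 < r by rewrite divr_gt0.
have r_ge1 : 1 <= r.
  by rewrite ler_pdivlMr// mul1r (le_trans eps_le)// tolerance0_le.
have D_ge1 : 1 <= r `^ (2 / alpha).
  by rewrite -[leLHS](powRr0 r) ler_powR// divr_ge0// ltW.
have [L L1 /andP[DL LD]] := exists_level s_gt1 D_ge1.
exists L, (schedule alpha k0 k1 k2 k3 lambda s); split=> //.
- by move=> l; exact: schedule_gt0.
- have KLL := KL_mlsvgd mTheta alpha_gt0 k0_gt0 k1_gt0 lambda_gt0 s_gt1 KL_init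
    KL_decay KL_levels R_bound L1.
  apply: le_trans (dHell_le_KL mTheta KLL (KL_target _ L1)) _.
  rewrite -[leRHS]gtr0_norm// -sqrtr_sqr ler_wsqrtr//.
  (* The lower bound on [s ^+ L], raised to the power [alpha]; it turns [2 k1 s^(-alpha L)] into at
     most [2 k1 / r^2 = eps^2]. *)
  have rs : r ^+ 2 <= s `^ (alpha * L%:R).
    rewrite mulrC powRrM powR_mulrn ?(ltW s_gt0)//.
    have := ge0_ler_powR (ltW alpha_gt0) (powR_ge0 _ _) (exprn_ge0 L (ltW s_gt0)) DL.
    by rewrite -powRrM divfK ?gt_eqF// (powR_mulrn _ (ltW r_gt0)).
  rewrite powRN -mulrDl -mulr2n -[k1 *+ 2]mulr_natl ler_pdivrMr ?powR_gt0//.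
  rewrite -ler_pdivrMl ?exprn_gt0// (le_trans _ rs)//.
  by rewrite /r expr_div_n sqr_sqrtr ?mulr_ge0 ?(ltW k1_gt0)// mulrC.
- by apply: schedule_cost => //; rewrite eps_gt0.
Qed.
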